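(* Let $k\in\mathbb{Z}$ and let $\phi(z)=z^2+\frac{k}{4}\in\mathbb{Q}[z]$. Then $\phi(z)$ is linearly conjugate to a morphism $g(z)\in\mathbb{Q}(z)$ with good reduction over $\mathbb{Q}$ if and only if $k\equiv 0$ or $1\pmod 4$.
   Context: Linearly conjugate means $g=\phi^f=f^{-1}\circ\phi\circ f$ for some linear fractional transformation $f(z)=\frac{az+b}{cz+d}\in\mathrm{PGL}_2(\mathbb{Q})$. For a prime $p$, write $g=F/G$ with all coefficients of $F,G$ $p$-integral and at least one a $p$-adic unit; $g$ has good reduction at $p$ if the rational map $\tilde g$ over $\mathbb{F}_p$ obtained by reducing the coefficients modulo $p$ (and cancelling common factors) satisfies $\deg\tilde g=\deg g$; equivalently, the resultant of the degree-$d$ homogenizations of $F,G$ (where $d=\deg g$) is a $p$-adic unit. $g$ has good reduction over $\mathbb{Q}$ if it has good reduction at every prime $p$. *)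

(* Defs.v *)
From HB Require Import structures.
From mathcomp Require Import all_boot all_order all_algebra.
From mathcomp Require Import generic_quotient.

Set Implicit Arguments.
Unset Strict Implicit.
Unset Printing Implicit Defensive.

Import Order.TTheory GRing.Theory Num.Theory.
Local Open Scope ring_scope.

(* Q(z), in the variable 'X. *)
Notation ratfun := {fraction {poly rat}}.

(* Degree of the rational map F / G over a field, after cancelling common
   factors. Meaningful for (F, G) != (0, 0); G = 0 is the constant map
   \infty, of degree 0. *)
Definition pair_degree (K : fieldType) (F G : {poly K}) : nat :=
  (maxn (size (F %/ gcdp F G)) (size (G %/ gcdp F G))).-1.

(* An arbitrary quotient representation of g, not necessarily reduced; the
   denominator is nonzero. *)
Definition numer (g : ratfun) : {poly rat} := \n_(repr g).
Definition denom (g : ratfun) : {poly rat} := \d_(repr g).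

Definition ratfun_degree (g : ratfun) : nat := pair_degree (numer g) (denom g).

Definition poly_at (P : {poly rat}) (f : ratfun) : ratfun :=
  (map_poly (fun c : rat => tofrac c%:P) P).[f].

(* g \o f. When f is nonconstant it is transcendental over Q, so the
   denominator does not vanish and the value does not depend on the chosen
   representation of g. Only nonconstant f are used below. *)
Definition ratfun_comp (g f : ratfun) : ratfun :=
  poly_at (numer g) f / poly_at (denom g) f.

(* A = [a, b; c, d] acts as (a z + b) / (c z + d). PGL_2(Q) is represented by
   invertible matrices: proportional matrices give the same function. *)
Definition mobius (A : 'M[rat]_2) : ratfun :=
  tofrac (A 0 0 *: 'X + (A 0 1)%:P) / tofrac (A 1 0 *: 'X + (A 1 1)%:P).

Definition linearly_conjugate (phi g : ratfun) : Prop :=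
  exists2 A : 'M[rat]_2, A \in unitmx &
    g = ratfun_comp (mobius (invmx A)) (ratfun_comp phi (mobius A)).

Section GoodReduction.

Variable p : nat.

Definition p_integral (q : rat) : bool := ~~ (p %| `|denq q|)%N.

Definition p_unit (q : rat) : bool := p_integral q && ~~ (p %| `|numq q|)%N.

(* For p prime and q p-integral, [ratr q : 'F_p] is the residue class
   numq q / denq q of q. *)
Definition reduce_poly (F : {poly rat}) : {poly 'F_p} := map_poly ratr F.

Definition normalized_form (g : ratfun) (F G : {poly rat}) : Prop :=
  [/\ G != 0, coprimep F G, g = tofrac F / tofrac G,
      forall i, p_integral F`_i && p_integral G`_i
    & exists i, p_unit F`_i || p_unit G`_i].

(* A normalized form exists and is unique up to a common p-unit factor, so the
   condition does not depend on (F, G). *)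
Definition good_reduction_at (g : ratfun) : Prop :=
  exists F G : {poly rat}, normalized_form g F G /\
    pair_degree (reduce_poly F) (reduce_poly G) = ratfun_degree g.

End GoodReduction.

Definition good_reduction (g : ratfun) : Prop :=
  forall p : nat, prime p -> good_reduction_at p g.

(* Main.v *)
Require Import Defs.
From mathcomp Require Import all_boot all_order all_algebra generic_quotient.
From mathcomp Require Import ring zify.
Import GRing.Theory.
Local Open Scope ring_scope.

(** Why the theorem is true.

    Write kappa = k / 4 and let g = A^-1 o (z^2 + kappa) o A with
    A = (a z + b) / (c z + d). In homogeneous coordinates g is the pair (P, Q)
    of binary quadratic forms determined by A (P, Q) = (N, M), where
    N = (a z + b)^2 + kappa (c z + d)^2 and M = (c z + d)^2
    ([conjugateE], [conjugate_coprime_form]).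

    Suppose that g has good reduction at 2. Since P and Q are coprime of maximal
    degree 2, a suitable multiple (F, G) of (P, Q) has integer coefficients and
    an odd resultant ([good_reduction_integral_pair]); here one needs that a
    pair of quadratic forms without a common factor has a nonzero resultant
    ([quad_res_neq0]).

    The map z^2 + kappa has the totally ramified fixed point oo, so g has the
    totally ramified fixed point A^-1(oo), a rational point. Clearing
    denominators, this point is [d : -c] with c and d coprime integers, and
    some matrix of SL_2(Z) carries oo to it. Conjugation by that matrix
    preserves integrality and the resultant, and turns (F, G) into
    (delta z^2 + beta z + gamma, l) with integers delta, beta, gamma, l
    ([integral_form_at_infinity]). The resultant of the latter pair is
    (l delta)^2, so l and delta are odd; and as
    (delta z^2 + beta z + gamma) / l is affinely conjugate to z^2 + k / 4,
    comparing discriminants yields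
      l^2 k = 4 gamma delta - beta^2 + 2 l beta.
    Modulo 4 this reads k = 2 l beta - beta^2, which is 0 for even beta and 1
    for odd beta ([odd_normal_form_mod4]).

    Conversely, k = 4 n + 2 beta - beta^2 with beta in {0, 1}, and translating
    by beta / 2 conjugates z^2 + k / 4 to z^2 + beta z + n, a monic polynomial
    with integer coefficients, which has good reduction everywhere
    ([conjugate_good_reduction], [monic_good_reduction]). *)

(** * Transcendental rational functions and composition *)

Definition cst : {rmorphism rat -> ratfun} := @tofrac _ \o polyC.

Lemma poly_atE P f : poly_at P f = (map_poly cst P).[f].
Proof. by []. Qed.

Definition transcendental (f : ratfun) : Prop := ~ algebraicOver cst f.

(** Transcendence over the constants is what makes substitution of [f] into
    rational functions well defined: no nonzero denominator vanishes at [f]. *)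
Lemma transcendental_neq0 P f : transcendental f -> P != 0 -> poly_at P f != 0.
Proof. by move=> ftr P0; apply/negP=> Pf0; apply: ftr; exists P. Qed.

Lemma transcendentalX : transcendental (tofrac 'X).
Proof.
case=> P P0; rewrite /root.
have -> : (map_poly cst P).[tofrac 'X] = tofrac P.
  rewrite (map_poly_comp (@tofrac _) polyC) horner_map /=.
  by rewrite -/(P \Po 'X) comp_polyXr.
by rewrite tofrac_eq0 (negPf P0).
Qed.

Lemma numer_denomE (g : ratfun) : g = tofrac (numer g) / tofrac (denom g).
Proof.
have d0 : tofrac (denom g) != 0 by rewrite tofrac_eq0 denom_ratioP.
apply: (canRL (mulfK d0)); rewrite -{1}(reprK g) !piE.
apply/eqmodP; rewrite /= FracField.equivfE /= /FracField.mulf !numden_Ratio.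
  by rewrite !mulr1 mulrC.
all: by rewrite ?mulr1 ?oner_neq0 ?denom_ratioP.
Qed.

(** Composition, defined through an arbitrary representative, can be computed
    from any representative. *)
Lemma ratfun_compE F G f : transcendental f -> G != 0 ->
  ratfun_comp (tofrac F / tofrac G) f = poly_at F f / poly_at G f.
Proof.
move=> ftr G0; set g := _ / _.
have d0 : denom g != 0 by exact: denom_ratioP.
apply/eqP; rewrite eqr_div ?transcendental_neq0 //.
rewrite !poly_atE -!hornerM -!rmorphM.
have /eqP := numer_denomE g.
rewrite {1}/g eqr_div ?tofrac_eq0 // -!tofracM tofrac_eq => /eqP H.
by rewrite /= -H.
Qed.

Lemma transcendental_comp (P : {poly rat}) f : (1 < size P)%N ->
  transcendental f -> transcendental (poly_at P f).
Proof.
move=> P1 ftr [R R0 Rf]; apply: ftr; exists (R \Po P).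
  by rewrite comp_poly_eq0.
by rewrite /root map_comp_poly horner_comp.
Qed.

(** * Conjugation by Mobius transformations *)

Lemma det_mx2 (R : comNzRingType) (A : 'M[R]_2) :
  \det A = A 0 0 * A 1 1 - A 0 1 * A 1 0.
Proof.
rewrite (expand_det_row _ 0) !big_ord_recl big_ord0 /cofactor !det_mx11 !mxE /=.
have -> : lift ord0 ord0 = 1 :> 'I_2 by apply/val_inj.
have -> : lift 1 0 = 0 :> 'I_2 by apply/val_inj.
by rewrite /bump /= !(addn0, add0n) expr0 expr1; ring.
Qed.

Lemma linear_poly_eq0 (R : nzRingType) (c d : R) :
  (c *: 'X + d%:P == 0) = (c == 0) && (d == 0).
Proof.
apply/eqP/andP=> [/polyP e|[/eqP-> /eqP->]]; last by rewrite scale0r addr0.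
have := (e 1, e 0); rewrite !coefE /= mulr1 mulr0 addr0 add0r => -[-> ->].
by rewrite eqxx.
Qed.

Lemma horner_map_linear (R S : nzRingType) (h : {rmorphism R -> S}) c d x :
  (map_poly h (c *: 'X + d%:P)).[x] = h c * x + h d.
Proof. by rewrite rmorphD /= map_polyZ map_polyX map_polyC !hornerE. Qed.

Lemma horner_map_XnaddC (R S : nzRingType) (h : {rmorphism R -> S}) n d x :
  (map_poly h ('X^n + d%:P)).[x] = x ^+ n + h d.
Proof. by rewrite rmorphD /= map_polyXn map_polyC hornerD hornerXn hornerC. Qed.

Section Conjugation.

Variable A : 'M[rat]_2.
Hypothesis Aunit : A \in unitmx.

Let a := A 0 0.
Let b := A 0 1.
Let c := A 1 0.
Let d := A 1 1.

Lemma unitmx2_det_neq0 : a * d - b * c != 0.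
Proof. by move: Aunit; rewrite unitmxE det_mx2 unitfE. Qed.

Lemma mobius_denom_neq0 : c *: 'X + d%:P != 0 :> {poly rat}.
Proof.
rewrite linear_poly_eq0; apply: contra unitmx2_det_neq0 => /andP[/eqP-> /eqP->].
by rewrite !mulr0 subrr.
Qed.

(** Inverting the Mobius map expresses ['X] rationally in terms of [mobius A],
    so if the latter were algebraic then so would be ['X]. *)
Lemma transcendental_mobius : transcendental (mobius A).
Proof.
move=> falg; apply: transcendentalX.
set f := mobius A in falg *; set x : ratfun := tofrac 'X.
have cstE z : tofrac z%:P = cst z by [].
have fE : f * (cst c * x + cst d) = cst a * x + cst b.
  have := mobius_denom_neq0; rewrite -tofrac_eq0 => M0.
  rewrite -!cstE -!tofracM -!tofracD !mul_polyC.
  by rewrite /f /mobius mulfVK.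
have [e|ne] := eqVneq (cst c * f) (cst a).
  (* Then f is the constant a / c = b / d, which forces a d = b c. *)
  have e' : cst b = cst d * f.
    by apply: (addrI (cst a * x)); rewrite -fE -e; ring.
  have /eqP[] : cst (a * d - b * c) != 0 by rewrite fmorph_eq0 unitmx2_det_neq0.
  by rewrite rmorphB !rmorphM -e e'; ring.
have -> : x = (cst b - cst d * f) / (cst c * f - cst a).
  apply: (canRL (mulfK _)); first by rewrite subr_eq0.
  have -> : cst b = f * (cst c * x + cst d) - cst a * x by rewrite fE; ring.
  by ring.
have algc z : algebraicOver cst (cst z) := algebraic_id cst z.
apply: (algebraic_div (algebraic_sub (algc b) (algebraic_mul (algc d) falg))).
exact: algebraic_sub (algebraic_mul (algc c) falg) (algc a).
Qed.

Lemma mobius_compE f : transcendental f ->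
  ratfun_comp (mobius A) f = (cst a * f + cst b) / (cst c * f + cst d).
Proof.
move=> ftr; rewrite /mobius ratfun_compE ?mobius_denom_neq0 //.
by rewrite !poly_atE !horner_map_linear.
Qed.

End Conjugation.

(** The conjugate of z^2 + kappa by [A] is the quotient P / Q of any two
    polynomials such that [A] sends (P, Q) to the numerator and denominator of
    (z^2 + kappa) o A. Characterizing P and Q by these equations avoids explicit
    entries of the inverse matrix, and fits both directions of the theorem. *)
Lemma conjugateE (A : 'M[rat]_2) (kappa : rat) (P Q : {poly rat}) :
    A \in unitmx ->
  let M := (A 1 0 *: 'X + (A 1 1)%:P) ^+ 2 in
    A 0 0 *: P + A 0 1 *: Q = (A 0 0 *: 'X + (A 0 1)%:P) ^+ 2 + kappa *: M ->
    A 1 0 *: P + A 1 1 *: Q = M ->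
  ratfun_comp (mobius (invmx A))
    (ratfun_comp (tofrac ('X^2 + kappa%:P)) (mobius A)) = tofrac P / tofrac Q.
Proof.
move=> Aunit M; set f := mobius A; set L := _ *: 'X + _ => PQ_N PQ_M.
have ftr : transcendental f by exact: transcendental_mobius.
set Phi : {poly rat} := 'X^2 + kappa%:P.
have Phi2 : (1 < size Phi)%N by rewrite size_XnaddC.
have M0 : tofrac M != 0 by rewrite tofrac_eq0 expf_neq0 ?mobius_denom_neq0.
set w := ratfun_comp (tofrac _) f.
have wE : w = poly_at Phi f.
  rewrite /w -[tofrac _]divr1 -tofrac1 ratfun_compE ?oner_eq0 //.
  by rewrite [poly_at 1 f]poly_atE rmorph1 hornerC divr1.
have wM : w * tofrac M = tofrac (L ^+ 2 + kappa *: M).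
  rewrite wE poly_atE horner_map_XnaddC mulrDl.
  rewrite tofracD -mul_polyC (tofracM kappa%:P); congr (_ + _).
  by rewrite /f /mobius expr_div_n -!tofracXn mulfVK.
have wtr : transcendental w by rewrite wE; exact: transcendental_comp.
have BA : invmx A *m A = 1%:M by rewrite mulVmx.
have Bunit : invmx A \in unitmx by rewrite unitmx_inv.
move: (invmx A) BA Bunit => B BA Bunit.
have BAE i j : B i 0 * A 0 j + B i 1 * A 1 j = (i == j)%:R.
  have := congr1 (fun m : 'M_2 => m i j) BA.
  rewrite !mxE !big_ord_recl big_ord0 addr0.
  by rewrite (_ : lift ord0 ord0 = 1 :> 'I_2) //; apply/val_inj.
(* The rows of B = A^-1 recover P and Q from N = w M and M. *)
have row i : (cst (B i 0) * w + cst (B i 1)) * tofrac M =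
             tofrac ((i == 0)%:R *: P + (i == 1)%:R *: Q).
  rewrite mulrDl -mulrA wM -!BAE -PQ_N -PQ_M.
  have cstE z : cst z = tofrac z%:P by [].
  rewrite !cstE -!tofracM -tofracD !mul_polyC; congr tofrac.
  by rewrite !scalerDr !scalerA !scalerDl addrACA.
rewrite mobius_compE // -(mulr1 (_ / _)) -(divff M0) mulf_div !row.
by rewrite /= !scale1r !scale0r addr0 add0r.
Qed.

(** * Degree and resultant of a pair of polynomials *)

Lemma pair_degree_coprime (K : fieldType) (F G : {poly K}) :
  coprimep F G -> pair_degree F G = (maxn (size F) (size G)).-1.
Proof.
move=> cFG; have g0 : gcdp F G != 0 by rewrite -size_poly_gt0 (eqP cFG).
by rewrite /pair_degree !size_divp // (eqP cFG) !subn0.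
Qed.

Lemma pair_degree_mull (K : fieldType) (h F G : {poly K}) :
  h != 0 -> coprimep F G -> pair_degree (h * F) (h * G) = pair_degree F G.
Proof.
move=> h0 cFG; rewrite (pair_degree_coprime _ _ _ cFG) /pair_degree.
have g1 : size (gcdp F G) = 1 by exact/eqP.
have g0 : gcdp F G != 0 by rewrite -size_poly_gt0 g1.
have sg : size (gcdp (h * F) (h * G)) = size h.
  rewrite (eqp_size (gcdp_mul2l _ _ _)) size_mul // g1.
  by rewrite addn1.
have g'0 : gcdp (h * F) (h * G) != 0.
  by rewrite -size_poly_gt0 sg size_poly_gt0.
have sdiv P : size (h * P %/ gcdp (h * F) (h * G)) = size P.
  have [->|P0] := eqVneq P 0; first by rewrite mulr0 div0p.
  rewrite size_divp // sg size_mul //.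
  by move: h0; rewrite -size_poly_gt0; case: (size h) => // n _; rewrite addKn.
by rewrite !sdiv.
Qed.

Lemma coprimep_proportional (K : fieldType) (F G P Q : {poly K}) :
  coprimep F G -> G != 0 -> P * G = F * Q -> exists h, P = h * F /\ Q = h * G.
Proof.
move=> cFG G0 e.
have /dvdpP[h Qh] : G %| Q.
  by rewrite -(Gauss_dvdpr Q (_ : coprimep G F)) 1?coprimep_sym // -e dvdp_mull.
exists h; split=> //; apply: (mulIf G0).
by rewrite e Qh; ring.
Qed.

Lemma ratfun_degreeE (F G : {poly rat}) : G != 0 -> coprimep F G ->
  ratfun_degree (tofrac F / tofrac G) = (maxn (size F) (size G)).-1.
Proof.
move=> G0 cFG; set g := _ / _.
have d0 : denom g != 0 by exact: denom_ratioP.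
have /eqP := numer_denomE g.
rewrite {1}/g eqr_div ?tofrac_eq0 // -!tofracM tofrac_eq => /eqP H.
have [h [e1 e2]] := coprimep_proportional _ _ _ _ _ cFG G0 (esym H).
rewrite /ratfun_degree e1 e2 pair_degree_mull ?pair_degree_coprime //.
by apply: contra_neq d0 => h0; rewrite e2 h0 mul0r.
Qed.

(** The resultant of two binary quadratic forms, whose coefficients are those of
    the polynomials in degrees at most 2. The degree 2 is fixed, as opposed to
    the actual degrees of [F] and [G], so that the formula commutes with
    reduction and detects a common zero at infinity. *)
Definition quad_res {R : comNzRingType} (F G : {poly R}) : R :=
  (F`_2 * G`_0 - F`_0 * G`_2) ^+ 2
  - (F`_2 * G`_1 - F`_1 * G`_2) * (F`_1 * G`_0 - F`_0 * G`_1).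

Lemma quad_res_map (R S : comNzRingType) (h : {rmorphism R -> S})
    (F G : {poly R}) :
  quad_res (map_poly h F) (map_poly h G) = h (quad_res F G).
Proof. by rewrite /quad_res !coef_map !(rmorphB, rmorphM, rmorphXn). Qed.

Lemma quad_resC (R : comNzRingType) (F G : {poly R}) :
  quad_res F G = quad_res G F.
Proof. by rewrite /quad_res; ring. Qed.

Lemma horner_quad (R : comNzRingType) (F : {poly R}) x :
  (size F <= 3)%N -> F.[x] = F`_2 * x ^+ 2 + F`_1 * x + F`_0.
Proof.
by move=> sF; rewrite (horner_coef_wide _ sF) !big_ord_recl big_ord0 /=; ring.
Qed.

(** Two quadratic forms with zero resultant have a common factor. If [F] has
    degree 2, eliminating the leading terms leaves the linear polynomial
    F_2 G - G_2 F = al X + be, and the resultant is be^2 - al ga with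
    ga = F_1 G_0 - F_0 G_1. If al = 0, then be = 0 and [F] divides [G].
    Otherwise the relation F_2 ga - F_1 be + F_0 al = 0 makes - be / al a root
    of [F], hence a common root. *)
Lemma quad_res_neq0 (K : fieldType) (F G : {poly K}) :
    (size F <= 3)%N -> (size G <= 3)%N -> maxn (size F) (size G) = 3 ->
  coprimep F G -> quad_res F G != 0.
Proof.
wlog sF : F G / size F = 3.
  move=> IH sF sG sFG cFG; move: (sFG); rewrite /maxn; case: ifP => _ e.
    by rewrite quad_resC; apply: IH; rewrite // 1?maxnC // coprimep_sym.
  exact: IH.
move=> _ sG _ cFG; apply/negP => /eqP res0.
have F2 : F`_2 != 0.
  by have := lead_coef_eq0 F; rewrite -size_poly_eq0 lead_coefE sF => ->.
pose al := F`_2 * G`_1 - F`_1 * G`_2; pose be := F`_2 * G`_0 - F`_0 * G`_2.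
have resE : be ^+ 2 = al * (F`_1 * G`_0 - F`_0 * G`_1).
  by apply/eqP; rewrite -subr_eq0 -/(quad_res F G) res0.
have relE : F`_2 *: G - G`_2 *: F = al *: 'X + be%:P.
  apply/polyP=> -[|[|[|i]]]; rewrite !coefE /= /al /be; try by ring.
  by rewrite ?(nth_default 0 (_ : (_ <= i.+3)%N)) ?sF ?(leq_trans sG) //; ring.
have [al0|al0] := eqVneq al 0.
  have be0 : be = 0 by apply/eqP; rewrite -sqrf_eq0 resE al0 mul0r.
  have : F %| F`_2 *: G.
    rewrite -[_ *: G](subrK (G`_2 *: F)) relE al0 be0 scale0r polyC0 !add0r.
    by rewrite -mul_polyC dvdp_mull.
  rewrite dvdpZr // => FG.
  by move: cFG; rewrite /coprimep (eqp_size (dvdp_gcd_idl FG)) sF.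
pose r := - be / al.
have Fr : F.[r] = 0.
  have al2 : al ^+ 2 != 0 by rewrite expf_neq0.
  apply: (mulIf al2); rewrite mul0r horner_quad ?sF //.
  have -> : (F`_2 * r ^+ 2 + F`_1 * r + F`_0) * al ^+ 2 =
            F`_2 * be ^+ 2 - F`_1 * al * be + F`_0 * al ^+ 2.
    by rewrite /r; field.
  by rewrite resE /al /be; ring.
have Gr : G.[r] = 0.
  apply: (mulfI F2); rewrite mulr0 -hornerZ.
  rewrite -[_ *: G](subrK (G`_2 *: F)) relE !hornerD !hornerZ.
  by rewrite hornerX hornerC Fr /r; field.
by have := coprimep_root cFG (introT eqP Fr); rewrite Gr eqxx.
Qed.

Lemma pair_degree2 (K : fieldType) (F G : {poly K}) :
    (size F <= 3)%N -> (size G <= 3)%N -> pair_degree F G = 2 ->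
  coprimep F G /\ maxn (size F) (size G) = 3.
Proof.
move=> sF sG.
have [g0|g0] := eqVneq (gcdp F G) 0.
  by rewrite /pair_degree g0 !divp0 size_poly0.
rewrite /pair_degree !size_divp // /coprimep.
move: g0; rewrite -size_poly_gt0; move: (size (gcdp F G)) sF sG => n.
move: (size F) (size G) => a b sF sG n0 /= e; split; first apply/eqP; lia.
Qed.

(** * Integral models with unit resultant *)

Section Reduction.

Variable p : nat.
Hypothesis p_prime : prime p.

Lemma intr_Fp_eq0 (n : int) : (n%:~R == 0 :> 'F_p) = (p %| `|n|)%N.
Proof.
rewrite (dvdn_pcharf (pchar_Fp p_prime)); case: n => n //=.
by rewrite NegzE rmorphN oppr_eq0.
Qed.

Lemma ratr_Fp (m n : int) (q : rat) :
  p_integral p q -> m%:~R * q = n%:~R -> m%:~R * ratr q = n%:~R :> 'F_p.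
Proof.
rewrite /p_integral -intr_Fp_eq0 => dq e.
have {}e : m * numq q = n * denq q.
  by apply/(@intr_inj rat); rewrite !rmorphM /= numqE -e mulrA.
by rewrite /ratr mulrA -rmorphM e rmorphM mulfK.
Qed.

(** The multiplier is prime to [p], so that it stays invertible in ['F_p]. *)
Lemma clear_denominators (s : seq rat) : all (p_integral p) s ->
  exists2 m : int, ~~ (p %| `|m|)%N & {in s, forall q, m%:~R * q \is a Num.int}.
Proof.
elim: s => [|q s IH] /=; first by exists 1; rewrite ?Euclid_dvd1.
case/andP=> qp /IH[m mp ms]; exists (m * denq q).
  by rewrite abszM Euclid_dvdM // negb_or mp.
move=> x; rewrite inE rmorphM /= => /predU1P[->|/ms mx].
  by rewrite -mulrA [_ * q]mulrC -numqE rpredM // Num.Theory.intr_int.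
by rewrite mulrAC rpredM // Num.Theory.intr_int.
Qed.

(** For quadratic maps, good reduction in terms of degrees provides
    an integral model with a resultant prime to [p]: reduction does not lose
    degree exactly when the reduced forms have no common factor. *)
Lemma good_reduction_integral_pair (g : ratfun) :
    ratfun_degree g = 2 -> good_reduction_at p g ->
  exists F G : {poly int}, [/\ map_poly intr G != 0 :> {poly rat},
    coprimep (map_poly intr F) (map_poly intr G : {poly rat}),
    g = tofrac (map_poly intr F) / tofrac (map_poly intr G) &
    ~~ (p %| `|quad_res F G|)%N].
Proof.
move=> deg2 [F [G [[G0 cFG gE FGint _]]]].
have := ratfun_degreeE F G G0 cFG; rewrite -gE deg2 => sFG.
have [sF sG] : (size F <= 3)%N /\ (size G <= 3)%N.
  by apply/andP; rewrite -geq_max; case: maxn sFG => // n /= <-.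
have [|m mp mint] := clear_denominators (F ++ G).
  rewrite all_cat; apply/andP.
  by split; apply/(all_nthP 0) => i _; case/andP: (FGint i).
have mF i : m%:~R * F`_i \is a Num.int.
  have [lt|ge] := ltnP i (size F); last by rewrite nth_default // mulr0.
  by apply: mint; rewrite mem_cat mem_nth.
have mG i : m%:~R * G`_i \is a Num.int.
  have [lt|ge] := ltnP i (size G); last by rewrite nth_default // mulr0.
  by apply: mint; rewrite mem_cat mem_nth ?orbT.
pose num (P : {poly rat}) : {poly int} := map_poly numq (m%:~R *: P).
have numE (P : {poly rat}) : (forall i, m%:~R * P`_i \is a Num.int) ->
    map_poly intr (num P) = m%:~R *: P.
  move=> Pint; apply/polyP => i.
  by rewrite coef_map coef_map_id0 ?coefZ //= numqK.
have redE (P : {poly rat}) : (forall i, p_integral p P`_i) ->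
    (forall i, m%:~R * P`_i \is a Num.int) ->
    map_poly intr (num P) = m%:~R *: reduce_poly p P.
  move=> Pp Pint; apply/polyP => i.
  have ratr0 : ratr 0 = 0 :> 'F_p by rewrite /ratr mul0r.
  rewrite coef_map coefZ coef_map_id0 // coef_map_id0 // coefZ /=.
  by rewrite (ratr_Fp m (numq (m%:~R * P`_i))) // numqK.
have m0 : m%:~R != 0 :> rat.
  by rewrite intr_eq0; apply: contraNneq mp => ->; rewrite absz0 dvdn0.
have mFp0 : m%:~R != 0 :> 'F_p by rewrite intr_Fp_eq0.
move=> red2; exists (num F), (num G); rewrite !numE //.
split; first by rewrite scaler_eq0 negb_or m0.
- by rewrite coprimepZl ?coprimepZr.
- have cm : tofrac m%:~R%:P != 0 :> ratfun by rewrite tofrac_eq0 polyC_eq0.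
  by rewrite gE -!mul_polyC !tofracM -mulf_div divff ?mul1r.
have Fp i : p_integral p F`_i by case/andP: (FGint i).
have Gp i : p_integral p G`_i by case/andP: (FGint i).
rewrite -intr_Fp_eq0 -quad_res_map !redE //.
have sr (P : {poly rat}) : (size P <= 3)%N -> (size (reduce_poly p P) <= 3)%N.
  by move=> sP; apply: leq_trans (size_poly _ _) _.
have [cr sr3] := pair_degree2 _ _ _ (sr _ sF) (sr _ sG) red2.
apply: quad_res_neq0; rewrite ?size_scale ?coprimepZl ?coprimepZr ?sr //.
Qed.

End Reduction.

(** * The quadratic forms of a conjugate of z^2 + kappa *)

Lemma sqr_linearE (R : comNzRingType) (a b : R) :
  (a *: 'X + b%:P) ^+ 2 = (a ^+ 2) *: 'X^2 + (2 * a * b) *: 'X + (b ^+ 2)%:P.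
Proof. by rewrite -!mul_polyC !polyCM; ring. Qed.

(** A common factor of P and Q divides both N = L^2 + kappa M and M, where
    L = a z + b is coprime to M = (c z + d)^2 because [A] is invertible. The
    maximal size is 3 because deg N, deg M <= 1 would give a = c = 0. *)
Lemma conjugate_coprime_form (A : 'M[rat]_2) (kappa : rat) : A \in unitmx ->
  let M := (A 1 0 *: 'X + (A 1 1)%:P) ^+ 2 in
  exists P Q : {poly rat},
    [/\ A 0 0 *: P + A 0 1 *: Q = (A 0 0 *: 'X + (A 0 1)%:P) ^+ 2 + kappa *: M,
        A 1 0 *: P + A 1 1 *: Q = M, Q != 0, coprimep P Q
      & maxn (size P) (size Q) = 3].
Proof.
move=> Aunit M; set N := _ ^+ 2 + _.
have D0 := unitmx2_det_neq0 A Aunit.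
move: @M @N D0; move: (A 0 0) (A 0 1) (A 1 0) (A 1 1) => a b c d M N D0.
set D := a * d - b * c in D0.
pose P := (d / D) *: N - (b / D) *: M; pose Q := (a / D) *: M - (c / D) *: N.
have PQ_N : a *: P + b *: Q = N.
  rewrite /P /Q -!mul_polyC.
  apply/polyP=> i; rewrite !(coefD, coefN, coefCM); rewrite /D; field.
  exact: D0.
have PQ_M : c *: P + d *: Q = M.
  rewrite /P /Q -!mul_polyC.
  apply/polyP=> i; rewrite !(coefD, coefN, coefCM); rewrite /D; field.
  exact: D0.
have cNM : coprimep N M.
  have cL : coprimep (a *: 'X + b%:P) (c *: 'X + d%:P).
    apply/Bezout_eq1_coprimepP; exists ((- c / D)%:P, (a / D)%:P) => /=.
    apply/polyP=> i; rewrite !coefE.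
    by case: i => [|[|i]] /=; rewrite /D; field; exact: D0.
  rewrite coprimep_sym /N addrC -mul_polyC coprimep_addl_mul /M.
  by rewrite coprimep_expl // coprimep_expr // coprimep_sym.
have cPQ : coprimep P Q.
  apply/coprimepP => h hP hQ; apply: (coprimepP _ _ cNM).
    by rewrite -PQ_N dvdp_add // -mul_polyC dvdp_mull.
  by rewrite -PQ_M dvdp_add // -mul_polyC dvdp_mull.
have sP : (size P <= 3)%N.
  apply/leq_sizeP => -[|[|[|i]]] // _.
  by rewrite /P /N /M !sqr_linearE !coefE /=; ring.
have sQ : (size Q <= 3)%N.
  apply/leq_sizeP => -[|[|[|i]]] // _.
  by rewrite /Q /N /M !sqr_linearE !coefE /=; ring.
have s3 : maxn (size P) (size Q) = 3.
  apply/eqP; rewrite eqn_leq geq_max sP sQ /= ltnNge geq_max.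
  apply: contra D0 => /andP[/leq_sizeP/(_ 2 isT) P2 /leq_sizeP/(_ 2 isT) Q2].
  have := congr1 (fun p : {poly rat} => p`_2) PQ_M.
  have := congr1 (fun p : {poly rat} => p`_2) PQ_N.
  rewrite /= !coefD !coefZ P2 Q2 /M !sqr_linearE !coefE /= !mulr0 !mulr1 !addr0.
  move=> e1 e2; have c0 : c = 0 by apply/eqP; rewrite -sqrf_eq0 -e2.
  have a0 : a = 0.
    by apply/eqP; rewrite -sqrf_eq0; apply/eqP; rewrite e1 c0; ring.
  by rewrite /D a0 c0 mul0r mulr0 subrr.
exists P, Q; split=> //.
apply: contraTneq cPQ => Q0; rewrite Q0 coprimep0 -size_poly_eq1.
by move: s3; rewrite Q0 size_poly0 maxn0 => ->.
Qed.

(** * Moving the totally ramified fixed point to infinity *)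

(** The substitution z -> (d z + x) / (- c z + y), in SL_2(Z), sends oo to the
    totally ramified fixed point [d : -c]. The conjugated pair
    (delta z^2 + beta z + gamma, l) has the same resultant, and over the
    rationals it is l times the conjugate of z^2 + kappa by z -> D z + e, where
    D = a d - b c and e = a x + b y. Reading off the coefficients gives
    l = lam, delta = lam D, beta = 2 lam e and
    D gamma = lam (e^2 + kappa - e), from which D and e are eliminated. *)
Lemma integral_form_at_infinity_coprime (a b kappa lam : rat)
    (c d x y : int) (F G : {poly int}) :
    c * x + d * y = 1 -> a * d%:~R - b * c%:~R != 0 ->
    a *: map_poly intr F + b *: map_poly intr G
      = lam *: ((a *: 'X + b%:P) ^+ 2
                + kappa *: (c%:~R *: 'X + d%:~R%:P) ^+ 2) ->
    c%:~R *: map_poly intr F + d%:~R *: map_poly intr G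
      = lam *: (c%:~R *: 'X + d%:~R%:P) ^+ 2 ->
  exists l delta beta gamma : int, quad_res F G = (l * delta) ^+ 2 /\
    l%:~R ^+ 2 * (4 * kappa)
      = (4 * gamma * delta - beta ^+ 2 + 2 * l * beta)%:~R.
Proof.
move=> cd1 D0.
rewrite !sqr_linearE => eN eM.
have cd1' : c%:~R * x%:~R + d%:~R * y%:~R = 1 :> rat.
  by rewrite -!intrM -intrD cd1.
have coN i := congr1 (fun p : {poly rat} => p`_i) eN.
have coM i := congr1 (fun p : {poly rat} => p`_i) eM.
have := (coN 0, coN 1, coN 2, coM 0, coM 1, coM 2).
rewrite /= !(coefD, coefZ, coef_map, coefXn, coefX, coefC) /=.
rewrite !(mulr0, mulr1, addr0, add0r) /=.
move=> [[[[[N0 N1] N2] M0] M1] M2].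
(* The coefficients of the forms F and G after the substitution. *)
pose F2 := F`_2 * d ^+ 2 - F`_1 * d * c + F`_0 * c ^+ 2.
pose F1 := 2 * F`_2 * d * x + F`_1 * (d * y - c * x) - 2 * F`_0 * c * y.
pose F0 := F`_2 * x ^+ 2 + F`_1 * x * y + F`_0 * y ^+ 2.
pose G2 := G`_2 * d ^+ 2 - G`_1 * d * c + G`_0 * c ^+ 2.
pose G1 := 2 * G`_2 * d * x + G`_1 * (d * y - c * x) - 2 * G`_0 * c * y.
pose G0 := G`_2 * x ^+ 2 + G`_1 * x * y + G`_0 * y ^+ 2.
pose D := a * d%:~R - b * c%:~R; pose e := a * x%:~R + b * y%:~R.
have comb2 s t : s * F2%:~R + t * G2%:~R =
    d%:~R ^+ 2 * (s * (F`_2)%:~R + t * (G`_2)%:~R)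
    - d%:~R * c%:~R * (s * (F`_1)%:~R + t * (G`_1)%:~R)
    + c%:~R ^+ 2 * (s * (F`_0)%:~R + t * (G`_0)%:~R) :> rat.
  by rewrite /F2 /G2; ring.
have comb1 s t : s * F1%:~R + t * G1%:~R =
    2 * d%:~R * x%:~R * (s * (F`_2)%:~R + t * (G`_2)%:~R)
    + (d%:~R * y%:~R - c%:~R * x%:~R) * (s * (F`_1)%:~R + t * (G`_1)%:~R)
    - 2 * c%:~R * y%:~R * (s * (F`_0)%:~R + t * (G`_0)%:~R) :> rat.
  by rewrite /F1 /G1; ring.
have comb0 s t : s * F0%:~R + t * G0%:~R =
    x%:~R ^+ 2 * (s * (F`_2)%:~R + t * (G`_2)%:~R)
    + x%:~R * y%:~R * (s * (F`_1)%:~R + t * (G`_1)%:~R)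
    + y%:~R ^+ 2 * (s * (F`_0)%:~R + t * (G`_0)%:~R) :> rat.
  by rewrite /F0 /G0; ring.
have one1 (z : rat) : z = z * (c%:~R * x%:~R + d%:~R * y%:~R).
  by rewrite cd1' mulr1.
have one2 (z : rat) : z = z * (c%:~R * x%:~R + d%:~R * y%:~R) ^+ 2.
  by rewrite cd1' expr1n mulr1.
have S2 : a * F2%:~R + b * G2%:~R = lam * D ^+ 2.
  by rewrite comb2 N0 N1 N2 /D; ring.
have S1 : a * F1%:~R + b * G1%:~R = 2 * lam * D * e.
  by rewrite comb1 N0 N1 N2 /D /e; ring.
have S0 : a * F0%:~R + b * G0%:~R = lam * (e ^+ 2 + kappa).
  by rewrite comb0 N0 N1 N2 [kappa in RHS](one2 kappa) /e; ring.
have T2 : c%:~R * F2%:~R + d%:~R * G2%:~R = 0 :> rat.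
  by rewrite comb2 M0 M1 M2; ring.
have T1 : c%:~R * F1%:~R + d%:~R * G1%:~R = 0 :> rat.
  by rewrite comb1 M0 M1 M2; ring.
have T0 : c%:~R * F0%:~R + d%:~R * G0%:~R = lam.
  by rewrite comb0 M0 M1 M2 [RHS]one2; ring.
(* (y u - x v, c u + d v) is the image of (u, v) under the inverse of the
   substitution matrix, which has determinant c x + d y = 1. *)
have cramer u v : D * (y%:~R * u - x%:~R * v) =
    (a * u + b * v) - e * (c%:~R * u + d%:~R * v).
  by rewrite [X in _ = X - _]one1 /D /e; ring.
pose l := c * F0 + d * G0; pose de := y * F2 - x * G2.
pose be := y * F1 - x * G1; pose ga := y * F0 - x * G0.
exists l, de, be, ga; split.
  have i2 : c * F2 + d * G2 = 0.
    by apply/(@intr_inj rat); rewrite rmorphD !rmorphM.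
  have i1 : c * F1 + d * G1 = 0.
    by apply/(@intr_inj rat); rewrite rmorphD !rmorphM.
  (* The resultant scales by det^4 under substitution in the variables and by
     det^2 under linear combination of the two forms. *)
  have -> : quad_res F G = (c * x + d * y) ^+ 6 * quad_res F G.
    by rewrite cd1 expr1n mul1r.
  transitivity ((de * l - ga * (c * F2 + d * G2)) ^+ 2
    - (de * (c * F1 + d * G1) - be * (c * F2 + d * G2))
      * (be * l - ga * (c * F1 + d * G1))).
    by rewrite /quad_res /l /de /be /ga /F2 /F1 /F0 /G2 /G1 /G0; ring.
  by rewrite i2 i1; ring.
have lE : l%:~R = lam by rewrite -T0 /l; ring.
have dE : de%:~R = lam * D.
  have -> : de%:~R = y%:~R * F2%:~R - x%:~R * G2%:~R :> rat.
    by rewrite /de; ring.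
  by apply: (mulfI D0); rewrite -/D cramer S2 T2; ring.
have bE : be%:~R = 2 * lam * e.
  have -> : be%:~R = y%:~R * F1%:~R - x%:~R * G1%:~R :> rat.
    by rewrite /be; ring.
  by apply: (mulfI D0); rewrite -/D cramer S1 T1; ring.
have gE : D * ga%:~R = lam * (e ^+ 2 + kappa - e).
  have -> : ga%:~R = y%:~R * F0%:~R - x%:~R * G0%:~R :> rat.
    by rewrite /ga; ring.
  by rewrite cramer S0 T0; ring.
move: l de be ga lE dE bE gE => l de be ga lE dE bE gE.
have -> : (4 * ga * de - be ^+ 2 + 2 * l * be)%:~R
    = 4 * de%:~R * ga%:~R - be%:~R ^+ 2 + 2 * l%:~R * be%:~R :> rat by ring.
rewrite lE dE bE; transitivity
  (4 * lam * (D * ga%:~R) - (2 * lam * e) ^+ 2 + 2 * lam * (2 * lam * e)).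
  by rewrite gE; ring.
by ring.
Qed.

Lemma coprime_multiple (c d : rat) : (c != 0) || (d != 0) ->
  exists (t : rat) (c0 d0 x y : int),
    [/\ t != 0, t * c = c0%:~R, t * d = d0%:~R & c0 * x + d0 * y = 1].
Proof.
move=> cd0; pose m := numq c * denq d; pose n := numq d * denq c.
have mE : m%:~R = c * (denq c * denq d)%:~R.
  by rewrite /m !intrM numqE; ring.
have nE : n%:~R = d * (denq c * denq d)%:~R.
  by rewrite /n !intrM numqE; ring.
have [u v uv _] := egcdzP m n.
have g0 : gcdz m n != 0.
  rewrite gcdz_eq0 /m /n !mulf_eq0 !numq_eq0 !(negPf (denq_neq0 _)) !orbF.
  by rewrite negb_and.
have g0r : (gcdz m n)%:~R != 0 :> rat by rewrite intr_eq0.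
exists ((denq c * denq d)%:~R / (gcdz m n)%:~R).
exists (m %/ gcdz m n)%Z, (n %/ gcdz m n)%Z, u, v; split.
- by rewrite mulf_neq0 ?invr_eq0 // intr_eq0 mulf_neq0.
- apply: (mulIf g0r); rewrite -[RHS]intrM divzK ?dvdz_gcdl // mE.
  by rewrite mulrAC mulfVK // mulrC.
- apply: (mulIf g0r); rewrite -[RHS]intrM divzK ?dvdz_gcdr // nE.
  by rewrite mulrAC mulfVK // mulrC.
apply: (mulIf g0); rewrite mul1r -[RHS]uv mulrDl.
rewrite ![_ * _ * gcdz m n]mulrAC !divzK ?dvdz_gcdl ?dvdz_gcdr //.
by rewrite [u * _]mulrC [v * _]mulrC.
Qed.

(** Rescaling the matrix makes (c, d) a pair of coprime integers; since N and M
    are quadratic in the matrix, this only changes [lam]. *)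
Lemma integral_form_at_infinity (a b c d kappa lam : rat) (F G : {poly int}) :
    a * d - b * c != 0 ->
    a *: map_poly intr F + b *: map_poly intr G
      = lam *: ((a *: 'X + b%:P) ^+ 2 + kappa *: (c *: 'X + d%:P) ^+ 2) ->
    c *: map_poly intr F + d *: map_poly intr G
      = lam *: (c *: 'X + d%:P) ^+ 2 ->
  exists l delta beta gamma : int, quad_res F G = (l * delta) ^+ 2 /\
    l%:~R ^+ 2 * (4 * kappa)
      = (4 * gamma * delta - beta ^+ 2 + 2 * l * beta)%:~R.
Proof.
move=> D0 eN eM.
have cd : (c != 0) || (d != 0).
  apply: contraNT D0; rewrite negb_or !negbK => /andP[/eqP-> /eqP->].
  by rewrite !mulr0 subrr.
have [t [c0 [d0 [x [y [t0 tc td xy]]]]]] := coprime_multiple c d cd.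
have scale (u v : rat) : (t * u) *: 'X + (t * v)%:P = t *: (u *: 'X + v%:P).
  by rewrite scalerDr scalerA -[t *: v%:P]mul_polyC polyCM.
apply: (integral_form_at_infinity_coprime (t * a) (t * b) kappa (lam / t)
          c0 d0 x y F G xy).
- rewrite -tc -td.
  have -> : t * a * (t * d) - t * b * (t * c) = t ^+ 2 * (a * d - b * c).
    by ring.
  by rewrite mulf_neq0 // expf_neq0.
- rewrite -tc -td !scale -!scalerA -scalerDr eN !exprZn.
  rewrite !(scalerDr, scalerA); congr (_ *: _ + _ *: _); field; exact: t0.
- rewrite -tc -td !scale -!scalerA -scalerDr eM !exprZn.
  rewrite !scalerA; congr (_ *: _); field; exact: t0.
Qed.

Lemma odd_normal_form_mod4 (k l delta beta gamma : int) : odd `|l| ->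
  l ^+ 2 * k = 4 * gamma * delta - beta ^+ 2 + 2 * l * beta ->
  (k = 0 %[mod 4])%Z \/ (k = 1 %[mod 4])%Z.
Proof.
move=> ol e.
(* With l = 2 m + 1 one has l^2 = 1 + 4 (m^2 + m), so l^2 k and k are congruent
   modulo 4. *)
have [m lE] : exists m, l = 2 * m + 1 by exists ((l - 1) %/ 2)%Z; lia.
have [s [bE|bE]] : exists s, beta = 2 * s \/ beta = 2 * s + 1.
    by exists (beta %/ 2)%Z; lia.
  left; apply/eqP; rewrite eqz_mod_dvd; apply/dvdzP.
  exists (gamma * delta - s ^+ 2 + l * s - (m ^+ 2 + m) * k).
  have -> : k - 0 = l ^+ 2 * k - 4 * (m ^+ 2 + m) * k by rewrite lE; ring.
  by rewrite e bE; ring.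
right; apply/eqP; rewrite eqz_mod_dvd; apply/dvdzP.
exists (gamma * delta - s ^+ 2 + 2 * m * s + m - (m ^+ 2 + m) * k).
have -> : k - 1 = l ^+ 2 * k - 4 * (m ^+ 2 + m) * k - 1 by rewrite lE; ring.
by rewrite e bE lE; ring.
Qed.

(** * Both directions of the criterion *)

Lemma monic_good_reduction (F : {poly int}) :
  F \is monic -> good_reduction (tofrac (map_poly intr F)).
Proof.
move=> Fmon p p_pr.
have redE (P : {poly int}) : reduce_poly p (map_poly intr P) = map_poly intr P.
  apply/polyP=> i; rewrite coef_map_id0 ?coef_map ?ratr_int //.
  by rewrite /ratr mul0r.
have pint (z : int) : p_integral p z%:~R.
  by rewrite /p_integral denq_int Euclid_dvd1.
have E1 : (1 : {poly rat}) = map_poly intr (1 : {poly int}) by rewrite rmorph1.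
have red1 : reduce_poly p 1 = 1 by rewrite E1 redE rmorph1.
exists (map_poly intr F), 1; split; last first.
  rewrite -[tofrac _]divr1 -tofrac1 ratfun_degreeE ?oner_neq0 ?coprimep1 //.
  rewrite red1 redE pair_degree_coprime ?coprimep1 // !size_poly1.
  congr (maxn _ _).-1.
  by rewrite !size_map_poly_id0 // (monicP Fmon) rmorph1 oner_neq0.
split; rewrite ?oner_neq0 ?coprimep1 ?tofrac1 ?divr1 //.
  by move=> i; rewrite E1 !coef_map !pint.
exists (size F).-1; rewrite coef_map /= -lead_coefE (monicP Fmon).
by rewrite /p_unit (pint 1) numq_int Euclid_dvd1.
Qed.

(** Translation by beta / 2 turns z^2 + kappa into the monic integral polynomial
    z^2 + beta z + n. *)
Lemma conjugate_good_reduction (kappa : rat) (beta n : int) :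
    4 * kappa = (4 * n + 2 * beta - beta ^+ 2)%:~R ->
  exists g, linearly_conjugate (tofrac ('X^2 + kappa%:P)) g /\ good_reduction g.
Proof.
move=> kappaE; pose F : {poly int} := 'X^2 + (beta *: 'X + n%:P).
exists (tofrac (map_poly intr F)); split; last first.
  apply: monic_good_reduction; rewrite monicE lead_coefDl ?lead_coefXn //.
  rewrite size_polyXn ltnS; apply/leq_sizeP => -[|[|i]] // _.
  by rewrite !coefE /= mulr0 addr0.
pose A : 'M[rat]_2 := \matrix_(i, j)
  if i == j then 1 else if i == 0 then beta%:~R / 2 else 0.
have [A00 A01 A10 A11] :
    [/\ A 0 0 = 1, A 0 1 = beta%:~R / 2, A 1 0 = 0 & A 1 1 = 1].
  by rewrite !mxE.
have Aunit : A \in unitmx.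
  by rewrite unitmxE det_mx2 A00 A01 A10 A11 mulr0 subr0 mulr1 unitr1.
exists A => //; rewrite (conjugateE A kappa (map_poly intr F) 1) //.
- by rewrite tofrac1 divr1.
- rewrite A00 A01 A10 A11 !sqr_linearE /F.
  apply/polyP=> i.
  rewrite !(coefD, coefZ, coef_map, coefXn, coefX, coefC, coef1) /=.
  have -> : kappa = n%:~R + beta%:~R / 2 - (beta%:~R / 2) ^+ 2.
    by apply: (mulfI (_ : 4 != 0)) => //; rewrite kappaE; field.
  by case: i => [|[|[|i]]] /=; field.
by rewrite A10 A11 !scale0r !add0r scale1r expr1n.
Qed.

Lemma good_reduction2_mod4 (k : int) (g : ratfun) :
    linearly_conjugate (tofrac ('X^2 + (k%:~R / 4%:R)%:P)) g ->
    good_reduction_at 2 g ->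
  (k = 0 %[mod 4])%Z \/ (k = 1 %[mod 4])%Z.
Proof.
set kappa := k%:~R / 4%:R; case=> A Aunit gE good2.
have [P [Q [PQ_N PQ_M Q0 cPQ sPQ]]] := conjugate_coprime_form A kappa Aunit.
move: gE; rewrite (conjugateE A kappa P Q) // => gE.
have deg2 : ratfun_degree g = 2 by rewrite gE ratfun_degreeE // sPQ.
have [F [G [G0 cFG gFG odd_res]]] :=
  good_reduction_integral_pair 2 isT g deg2 good2.
have [h [Ph Qh]] : exists h, P = h * map_poly intr F /\ Q = h * map_poly intr G.
  apply: coprimep_proportional => //; apply/eqP.
  rewrite -tofrac_eq !tofracM -eqr_div ?tofrac_eq0 //.
  by move/eqP: gFG; rewrite gE.
have /size_poly1P[z z0 hE] : size h == 1.
  have /eqp_size-> : h %= 1.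
    by apply: (coprimepP _ _ cPQ); rewrite ?Ph ?Qh dvdp_mulr.
  by rewrite size_poly1.
have lamE (s t : rat) : s *: map_poly intr F + t *: map_poly intr G
    = z^-1 *: (s *: P + t *: Q).
  rewrite Ph Qh hE !mul_polyC !scalerDr !scalerA.
  by congr (_ *: _ + _ *: _); field; exact: z0.
have D0 := unitmx2_det_neq0 A Aunit.
have [||l [de [be [ga [resE lkE]]]]] :=
  integral_form_at_infinity _ _ _ _ kappa z^-1 F G D0.
- by rewrite lamE PQ_N.
- by rewrite lamE PQ_M.
apply: (odd_normal_form_mod4 k l de be ga).
  move: odd_res; rewrite resE abszX abszM Euclid_dvdX // Euclid_dvdM //.
  by rewrite andbT negb_or !dvdn2 !negbK => /andP[].
by apply/(@intr_inj rat); rewrite -lkE /kappa; field.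
Qed.

Theorem proposition4p4 (k : int) :
  (exists g : ratfun,
      linearly_conjugate (tofrac ('X^2 + (k%:~R / 4%:R)%:P)) g /\
      good_reduction g)
  <-> (k = 0 %[mod 4])%Z \/ (k = 1 %[mod 4])%Z.
Proof.
split=> [[g [conj good]]|k01].
  exact: (good_reduction2_mod4 k g conj (good 2 isT)).
have [beta betaE] :
    exists beta : int, k = 4 * (k %/ 4)%Z + 2 * beta - beta ^+ 2.
  by case: k01 => k4; [exists 0|exists 1]; lia.
apply: (conjugate_good_reduction _ beta (k %/ 4)%Z).
by rewrite -betaE mulrC divfK.
Qed.
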